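(* Let $0<\alpha<1$ and let $k\ge 1$ be an integer. Let $(P_i)_{i\ge 0}$ be an $\alpha$-random walk in $\mathbb{Z}^2$ starting at the origin, and for $i\ge 1$ let $X_i=1$ if $P_i$ is $k$-free and $X_i=0$ otherwise. For $n\ge 1$ put $$\overline{T}_n=\frac{X_1X_2+X_2X_3+\cdots+X_nX_{n+1}}{n}.$$ Then $$\lim_{n\to+\infty}\overline{T}_n=\prod_{p}\Big(1-\frac{2}{p^{2k}}\Big)$$ almost surely, where the infinite product is over all primes $p$.
   Context: For an integer $k\ge 1$, a positive integer is $k$-free if it is not divisible by $p^k$ for any prime $p$ (so the only $1$-free positive integer is $1$). A non-zero lattice point $(m,n)\in\mathbb{Z}^2$ is $k$-free if $\gcd(m,n)$ is $k$-free. For $0<\alpha<1$, an $\alpha$-random walk starting at the origin is the sequence of random points $P_0=(0,0)$ and $P_{i+1}=P_i+\xi_{i+1}$ for $i=0,1,2,\dots$, where the steps $\xi_1,\xi_2,\dots$ are independent, each equal to $(1,0)$ with probability $\alpha$ and to $(0,1)$ with probability $1-\alpha$. *)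

(* Defs.v *)
From HB Require Import structures.
From mathcomp Require Import all_boot all_order all_algebra finmap.
From mathcomp Require Import all_classical all_reals all_analysis.

Set Implicit Arguments.
Unset Strict Implicit.
Unset Printing Implicit Defensive.

Import Order.TTheory GRing.Theory Num.Theory.
Import numFieldNormedType.Exports.

Local Open Scope classical_set_scope.
Local Open Scope ring_scope.

HB.instance Definition _ := isPointed.Build int 0.
(* The discrete sigma-algebra on int; int * int then carries the product
   sigma-algebra, for which every set is measurable by countability. *)
HB.instance Definition _ := @isMeasurable.Build default_measure_display
  int (@discrete_measurable int) (@discrete_measurable0 int)
  (@discrete_measurableC int) (@discrete_measurableU int).

Definition kfree (k n : nat) : Prop :=
  (0 < n)%N /\ forall p : nat, prime p -> ~~ (p ^ k %| n)%N.

Definition kfree_point (k : nat) (v : int * int) : Prop :=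
  v != (0, 0) /\ kfree k `|gcdz v.1 v.2|%N.

Definition mutually_independent d d' (T : measurableType d)
    (T' : measurableType d') (R : realType) (P : probability T R)
    (I : choiceType) (X : I -> {RV P >-> T'}) : Prop :=
  forall (J : {fset I}) (B : I -> set T'),
    (forall i, i \in J -> measurable (B i)) ->
    P (\bigcap_(i in [set` J]) (X i @^-1` B i)) =
      (\prod_(i <- J) P (X i @^-1` B i))%E.

(* xi i is the step from W i to W i.+1, i.e. the (i + 1)-st step. *)
Definition alpha_random_walk d (T : measurableType d) (R : realType)
    (P : probability T R) (alpha : R) (W : nat -> T -> int * int) : Prop :=
  exists xi : nat -> {RV P >-> (int * int)%type},
    [/\ mutually_independent xi,
        forall i, P (xi i @^-1` [set (1, 0)]) = alpha%:E,
        forall i, P (xi i @^-1` [set (0, 1)]) = (1 - alpha)%:E,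
        forall t, W 0%N t = (0, 0)
      & forall i t, W i.+1 t = W i t + xi i t].

Section averages.
Context (R : realType) (T : Type) (k : nat) (W : nat -> T -> int * int).

Definition kfree_indicator (i : nat) (t : T) : R :=
  \1_[set v | kfree_point k v] (W i t).

Definition Tbar (n : nat) (t : T) : R :=
  (\sum_(1 <= i < n.+1) kfree_indicator i t * kfree_indicator i.+1 t) / n%:R.

End averages.

Section euler_product.
Context (R : realType) (k : nat).

Definition euler_partial (N : nat) : R :=
  \prod_(0 <= p < N | prime p) (1 - 2 / p%:R ^+ (2 * k)).

Definition euler_product : R := limn euler_partial.

Lemma is_cvg_euler_partial : (0 < k)%N -> cvgn euler_partial.
Proof.
move=> k0.
have F p : prime p -> 0 <= 1 - 2 / (p%:R : R) ^+ (2 * k) <= 1.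
  move=> pp; have p1 : 1 <= p%:R :> R by rewrite ler1n prime_gt0.
  have p4 : 2 <= p%:R ^+ (2 * k) :> R.
    apply: (@le_trans _ _ p%:R); first by rewrite ler_nat prime_gt1.
    by rewrite -[leLHS]expr1; apply: ler_weXn2l => //; rewrite muln_gt0.
  have p0 : 0 < p%:R ^+ (2 * k) :> R by apply: lt_le_trans p4.
  by rewrite subr_ge0 ler_pdivrMr// mul1r p4 lerBlDr lerDl divr_ge0// ltW.
have P0 N : 0 <= euler_partial N.
  by apply: prodr_ge0 => p /F /andP[].
apply: nonincreasing_is_cvgn; last by exists 0 => _ [N _ <-].
apply/nonincreasing_seqP => N.
rewrite /euler_partial big_mkcond big_nat_recr//= -big_mkcond/=.
case: ifPn => [/F /andP[_ le1]|_]; last by rewrite mulr1.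
by rewrite ler_piMr //; exact: P0.
Qed.

End euler_product.

(* Main.v *)
Require Import Defs.
From mathcomp Require Import all_boot all_order all_algebra.
From mathcomp Require Import finmap ring lra zify.
From mathcomp Require Import all_classical all_reals all_analysis.

(** Write S_i for the number of steps (1, 0) among the first i steps.  Almost
    surely the i-th point is (S_i, i - S_i), so it is k-free exactly when no
    prime p has p^k dividing both S_i and i.

    Fix M and only sieve by the primes below M.  The sieved condition on two
    consecutive points is periodic in i and S_i.  The engine is a quantitative
    equidistribution: Stein's identity for the binomial law
    (coin_mean_stein) gives that the distribution of S_n is almost invariant
    under a unit shift, with error O(n^(-1/2)) (coin_mean_shift), and summation
    turns this into |E f(a + S_n) - mean of f| = O(n^(-1/2)) for periodic f,
    uniformly in the start a (coin_mean_periodic).  By the Markov property the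
    covariance of terms of index i < j is then O((j - i)^(-1/2)), and a sum of n
    centered terms has second moment O(n^(3/2)) (coin_mean_sqr_sum).  The
    limiting mean is a count of residues, which the Chinese remainder theorem
    factors into the product of 1 - 2 / p^(2k) over p < M (sum_sieve_step).

    The price of the sieve is a count of common divisors d >= M of S_i and i
    (sum_kfree_sieve).  Since the equidistribution is uniform in the modulus,
    the divisors below a small power z of n obey the same second moment bound
    around their mean, which is at most 2 n / M, and the divisors from z on are
    already negligible in mean.

    Along n = m^12 with z = m^2 all exceptional events have probability
    O(m^(-2)) (coin_mean_atypical), so by the Borel-Cantelli lemma almost surely
    only finitely many occur, for every M at once.  Gaps between consecutive
    twelfth powers are negligible, and M tends to infinity
    (cvg_average_subsequence). *)

Import Order.TTheory GRing.Theory Num.Theory.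
Import numFieldNormedType.Exports.

Local Open Scope classical_set_scope.
Local Open Scope ring_scope.

Set Implicit Arguments.
Unset Strict Implicit.
Unset Printing Implicit Defensive.

(** * Means over finitely many coins and Stein's identity *)

Section coin_mean.
Context (R : realType) (alpha : R).
Implicit Types (f g : seq bool -> R) (n m : nat) (c : R).

(** Only events depending on finitely many steps ever get estimated, so a finite
    recursion over the coins replaces integrals on the probability space. *)
Fixpoint coin_mean n f : R :=
  if n is m.+1 then
    alpha * coin_mean m (fun s => f (true :: s)) +
    (1 - alpha) * coin_mean m (fun s => f (false :: s))
  else f [::].

Lemma eq_coin_mean n f g : (forall s, size s = n -> f s = g s) ->
  coin_mean n f = coin_mean n g.
Proof.
elim: n f g => [|n IHn] f g fg /=; first exact: fg.
by congr (_ * _ + _ * _); apply: IHn => s sn; apply: fg; rewrite /= sn.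
Qed.

Lemma coin_meanD n f g :
  coin_mean n (fun s => f s + g s) = coin_mean n f + coin_mean n g.
Proof. by elim: n f g => [//|n IHn] f g /=; rewrite !IHn; ring. Qed.

Lemma coin_meanZ n c f : coin_mean n (fun s => c * f s) = c * coin_mean n f.
Proof. by elim: n f => [//|n IHn] f /=; rewrite !IHn; ring. Qed.

Lemma coin_mean_cst n c : coin_mean n (fun=> c) = c.
Proof. by elim: n => [//|n IHn] /=; rewrite IHn; ring. Qed.

Lemma coin_meanB n f g :
  coin_mean n (fun s => f s - g s) = coin_mean n f - coin_mean n g.
Proof.
under eq_coin_mean do rewrite -mulN1r.
by rewrite coin_meanD coin_meanZ mulN1r.
Qed.

Lemma coin_mean_sum n (I : Type) (r : seq I) (Q : pred I) (F : I -> seq bool -> R) :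
  coin_mean n (fun s => \sum_(i <- r | Q i) F i s) =
  \sum_(i <- r | Q i) coin_mean n (F i).
Proof.
elim: r => [|i r IHr].
  rewrite big_nil -[RHS](coin_mean_cst n); apply: eq_coin_mean => s _.
  by rewrite big_nil.
under eq_coin_mean do rewrite big_cons.
rewrite big_cons; case: ifP => _; last exact: IHr.
by rewrite coin_meanD IHr.
Qed.

Lemma coin_mean_cat n m f :
  coin_mean (n + m) f = coin_mean n (fun u => coin_mean m (fun v => f (u ++ v))).
Proof. by elim: n f => [//|n IHn] f; rewrite addSn /= !IHn. Qed.

Lemma coin_mean_rcons n f : coin_mean n.+1 f =
  coin_mean n (fun u => alpha * f (rcons u true) + (1 - alpha) * f (rcons u false)).
Proof.
rewrite -addn1 coin_mean_cat; apply: eq_coin_mean => u _ /=.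
by rewrite !cats1.
Qed.

(** Stein's identity for the binomial law.  Conditioning on the first coin
    reproduces the left-hand side with one coin fewer, and adds one copy of the
    mean of the discrete derivative of g; there are n + 1 coins to remove. *)
Lemma coin_mean_stein n (g : nat -> R) :
  coin_mean n.+1 (fun s => ((count id s)%:R - n.+1%:R * alpha) * g (count id s)) =
  n.+1%:R * (alpha * (1 - alpha)) *
    coin_mean n (fun s => g (count id s).+1 - g (count id s)).
Proof.
have step m (h : nat -> R) :
    coin_mean m.+1 (fun s => ((count id s)%:R - m.+1%:R * alpha) * h (count id s)) =
    alpha * coin_mean m
      (fun s => ((count id s)%:R - m%:R * alpha) * h (count id s).+1) +
    (1 - alpha) * coin_mean m
      (fun s => ((count id s)%:R - m%:R * alpha) * h (count id s)) +
    alpha * (1 - alpha) * coin_mean m (fun s => h (count id s).+1 - h (count id s)).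
  rewrite /= -!coin_meanZ -!coin_meanD; apply: eq_coin_mean => s _.
  rewrite add1n add0n -!natr1; ring.
elim: n g => [|n IHn] g; first by rewrite step /=; ring.
rewrite step (IHn (fun j => g j.+1)) IHn -[n.+2%:R]natr1.
set e := coin_mean n.+1 (fun s => g (count id s).+1 - g (count id s)).
have -> : e = alpha * coin_mean n (fun s => g (count id s).+2 - g (count id s).+1) +
  (1 - alpha) * coin_mean n (fun s => g (count id s).+1 - g (count id s)) by [].
ring.
Qed.

(** Stein's identity for g(S) = S - n alpha, whose discrete derivative is 1. *)
Lemma coin_mean_variance n :
  coin_mean n (fun s => ((count id s)%:R - n%:R * alpha) ^+ 2) =
  n%:R * (alpha * (1 - alpha)).
Proof.
case: n => [|n]; first by rewrite /= !mul0r subrr expr0n.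
under eq_coin_mean do rewrite expr2.
rewrite (@coin_mean_stein n (fun j => j%:R - n.+1%:R * alpha)).
under eq_coin_mean.
  move=> s _; have -> : (count id s).+1%:R - n.+1%:R * alpha -
    ((count id s)%:R - n.+1%:R * alpha) = 1 by rewrite -natr1; ring.
  over.
by rewrite coin_mean_cst mulr1.
Qed.

Hypothesis alpha01 : 0 < alpha < 1.

Lemma ler_coin_mean n f g : (forall s, size s = n -> f s <= g s) ->
  coin_mean n f <= coin_mean n g.
Proof.
have /andP[/ltW a0 /ltW a1] := alpha01.
elim: n f g => [|n IHn] f g fg /=; first exact: fg.
by apply: lerD; apply: ler_wpM2l; rewrite ?subr_ge0//;
  apply: IHn => s sn; apply: fg; rewrite /= sn.
Qed.

Lemma ler_norm_coin_mean n f : `|coin_mean n f| <= coin_mean n (fun s => `|f s|).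
Proof.
rewrite ler_norml -mulN1r -coin_meanZ; apply/andP; split;
  apply: ler_coin_mean => s _; rewrite ?mulN1r ?ler_norm//.
by rewrite lerNl -normrN ler_norm.
Qed.

Lemma coin_mean_chebyshev n f (lambda : R) : 0 < lambda ->
  coin_mean n (fun s => (lambda < `|f s|)%R%:R) <=
  coin_mean n (fun s => f s ^+ 2) / lambda ^+ 2.
Proof.
move=> l0; rewrite mulrC -coin_meanZ; apply: ler_coin_mean => s _.
rewrite ler_pdivlMl ?exprn_gt0//; case: ltP => [lf|_].
  rewrite mulr1 -[leRHS]real_normK ?num_real//.
  by rewrite lerXn2r ?nnegrE ?normr_ge0 ?(ltW l0) ?(ltW lf).
by rewrite mulr0 sqr_ge0.
Qed.

Lemma coin_mean_markov n f (lambda : R) : 0 < lambda ->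
  (forall s, size s = n -> 0 <= f s) ->
  coin_mean n (fun s => (lambda < f s)%R%:R) <= coin_mean n f / lambda.
Proof.
move=> l0 f0; rewrite mulrC -coin_meanZ; apply: ler_coin_mean => s sn.
rewrite ler_pdivlMl//; case: ltP => [lf|_]; first by rewrite mulr1 ltW.
by rewrite mulr0 f0.
Qed.

(** The inverse of the standard deviation of one coin. *)
Definition smooth_const : R := (Num.sqrt (alpha * (1 - alpha)))^-1.

Lemma smooth_const_gt0 : 0 < smooth_const.
Proof.
have /andP[a0 a1] := alpha01.
by rewrite invr_gt0 sqrtr_gt0 mulr_gt0// subr_gt0.
Qed.

(** The heads count spreads over about sqrt n values, so a bounded function
    has nearly the same mean before and after a unit shift.  Stein's identity
    turns the difference into the mean of (S - n alpha) G(S), which is at most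
    the standard deviation of S times the bound of G. *)
Lemma coin_mean_shift n (G : nat -> R) (B : R) : (forall j, `|G j| <= B) ->
  `|coin_mean n (fun s => G (count id s).+1 - G (count id s))| <=
  B * smooth_const / Num.sqrt n.+1%:R.
Proof.
move=> GB; have /andP[a0 a1] := alpha01.
have v0 : 0 < alpha * (1 - alpha) by rewrite mulr_gt0// subr_gt0.
have n0 : 0 < n.+1%:R :> R by rewrite ltr0n.
have B0 : 0 <= B by rewrite (le_trans _ (GB 0%N)).
set v := Num.sqrt (n.+1%:R * (alpha * (1 - alpha))).
have nv0 : 0 < n.+1%:R * (alpha * (1 - alpha)) by rewrite mulr_gt0.
have vv : v ^+ 2 = n.+1%:R * (alpha * (1 - alpha)) by rewrite sqr_sqrtr ?ltW.
have vgt0 : 0 < v by rewrite sqrtr_gt0.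
have -> : B * smooth_const / Num.sqrt n.+1%:R = v * B / v ^+ 2.
  have -> : smooth_const = Num.sqrt n.+1%:R / v.
    rewrite /smooth_const /v (sqrtrM _ (ltW n0)); field.
    by rewrite !gt_eqF ?sqrtr_gt0.
  by field; rewrite !gt_eqF ?sqrtr_gt0.
rewrite ler_pdivlMr ?exprn_gt0// -[X in _ * X]gtr0_norm ?exprn_gt0//.
rewrite -normrM mulrC vv -coin_mean_stein.
apply: le_trans (ler_norm_coin_mean _ _) _.
(* AM-GM, balanced at the standard deviation v, bounds the first absolute
   moment by the second moment. *)
apply: (@le_trans _ _ (coin_mean n.+1 (fun s =>
    B / (2 * v) * (((count id s)%:R - n.+1%:R * alpha) ^+ 2) + B * v / 2))).
  apply: ler_coin_mean => s _; rewrite normrM.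
  set x := _ - _.
  apply: (@le_trans _ _ (`|x| * B)); first by rewrite ler_wpM2l.
  have -> : B / (2 * v) * x ^+ 2 + B * v / 2 =
      `|x| * B + B / (2 * v) * (`|x| - v) ^+ 2.
    by rewrite (sqrrB `|x|) real_normK ?num_real//; field; rewrite gt_eqF.
  by rewrite lerDl mulr_ge0 ?sqr_ge0// divr_ge0// mulr_ge0// ltW.
rewrite coin_meanD coin_meanZ coin_mean_cst coin_mean_variance -vv.
by rewrite le_eqVlt; apply/orP; left; apply/eqP; field; rewrite gt_eqF.
Qed.

End coin_mean.

(** * Equidistribution of the heads count and a second moment bound *)

Section periodic.
Context (R : realType).
Implicit Types (f : nat -> R) (Q : nat).

Definition period_mean Q f : R := (\sum_(0 <= t < Q) f t) / Q%:R.

Lemma sum_period_shift Q f a : (forall s, f (s + Q)%N = f s) ->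
  \sum_(0 <= t < Q) f (a + t)%N = \sum_(0 <= t < Q) f t.
Proof.
move=> fQ; elim: a => [//|a <-]; case: Q fQ => [|Q] fQ; first by rewrite !big_nil.
rewrite big_nat_recr// [RHS]big_nat_recl//= addrC addn0 addSnnS fQ.
by congr (_ + _); apply: eq_bigr => t _; rewrite addSnnS.
Qed.

(** A full period contributes 0, so only an incomplete period remains. *)
Lemma ler_norm_sum_periodic Q f s : (0 < Q)%N -> (forall s, f (s + Q)%N = f s) ->
  `|\sum_(0 <= t < s) (f t - period_mean Q f)| <=
  \sum_(0 <= t < Q) `|f t - period_mean Q f|.
Proof.
move=> Q0 fQ; elim/ltn_ind: s => s IHs; have [sQ|Qs] := ltnP s Q.
  apply: le_trans (ler_norm_sum _ _ _) _.
  by rewrite (big_cat_nat (n := s) _ (ltnW sQ))//= lerDl sumr_ge0.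
rewrite (big_cat_nat (n := Q))//= [X in `|X + _|](_ : _ = 0) ?add0r; last first.
  rewrite sumrB sumr_const_nat subn0 /period_mean -(mulr_natr (_ / _) Q).
  by rewrite divfK ?subrr// pnatr_eq0 -lt0n.
rewrite -{1}(add0n Q) big_addn.
under eq_bigr do rewrite fQ.
by apply: IHs; rewrite ltn_subrL Q0 (leq_trans Q0).
Qed.

Lemma period_mean_itv Q f : (0 < Q)%N -> (forall t, 0 <= f t <= 1) ->
  0 <= period_mean Q f <= 1.
Proof.
move=> Q0 f01; rewrite /period_mean ler_pdivrMr ?ltr0n// mul1r.
rewrite divr_ge0//=; last by rewrite sumr_ge0// => t _; case/andP: (f01 t).
rewrite -[leRHS](_ : \sum_(0 <= t < Q) 1 = _).
  by apply: ler_sum => t _; case/andP: (f01 t).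
by rewrite sumr_const_nat subn0.
Qed.

Lemma ler_sum_period_dev Q f : (0 < Q)%N -> (forall t, 0 <= f t <= 1) ->
  \sum_(0 <= t < Q) `|f t - period_mean Q f| <= Q%:R.
Proof.
move=> Q0 f01; have m01 := period_mean_itv Q0 f01.
rewrite -[leRHS](_ : \sum_(0 <= t < Q) 1 = _); last first.
  by rewrite sumr_const_nat subn0.
by apply: ler_sum => t _; have := f01 t; rewrite ler_norml; lra.
Qed.

Lemma sum_inv_sqrt n :
  \sum_(0 <= i < n) (Num.sqrt i.+1%:R)^-1 <= 2 * Num.sqrt n%:R :> R.
Proof.
elim: n => [|n IHn]; first by rewrite big_nil sqrtr0 mulr0.
rewrite big_nat_recr//=; apply: le_trans (lerD IHn (lexx _)) _.
set x := Num.sqrt n%:R; set y := Num.sqrt n.+1%:R.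
have y0 : 0 < y by rewrite sqrtr_gt0 ltr0n.
have yy : y ^+ 2 = x ^+ 2 + 1 by rewrite !sqr_sqrtr ?ler0n// natr1.
rewrite -(ler_pM2r y0) mulrDl mulVf ?gt_eqF//.
have := sqr_ge0 (y - x); nra.
Qed.

End periodic.

Section heads_count.
Context (R : realType) (alpha : R).
Hypothesis alpha01 : 0 < alpha < 1.
Local Notation coin_mean := (coin_mean alpha).
Local Notation kappa := (smooth_const alpha).

(** The partial sums G of f minus its mean stay bounded because f is periodic,
    and their discrete derivative is f minus its mean: the shift estimate for G
    is the claim.  It is uniform in the starting point a and, for indicators of
    residue classes, in the period. *)
Lemma coin_mean_periodic n Q (f : nat -> R) a :
  (0 < Q)%N -> (forall s, f (s + Q)%N = f s) ->
  `|coin_mean n (fun s => f (a + count id s)%N) - period_mean Q f| <=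
  (\sum_(0 <= t < Q) `|f t - period_mean Q f|) * kappa / Num.sqrt n.+1%:R.
Proof.
move=> Q0 fQ; set m := period_mean Q f.
pose G j := \sum_(0 <= t < j) (f (a + t)%N - m).
have faQ s : f (a + (s + Q))%N = f (a + s)%N by rewrite addnA fQ.
have ma : m = period_mean Q (fun t => f (a + t)%N).
  by rewrite /period_mean sum_period_shift.
have -> : coin_mean n (fun s => f (a + count id s)%N) - m =
    coin_mean n (fun s => G (count id s).+1 - G (count id s)).
  rewrite -{1}(coin_mean_cst alpha n m) -coin_meanB.
  by apply: eq_coin_mean => s _; rewrite /G big_nat_recr//= addrAC subrr add0r.
apply: coin_mean_shift => // j.
have /= <- := @sum_period_shift _ Q (fun t => `|f t - m|) a
  (fun s => congr1 (fun z => `|z - m|) (fQ s)).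
by rewrite /G ma; apply: (ler_norm_sum_periodic (f := fun t => f (a + t)%N)).
Qed.

(** Up to the factor B, the covariance of the terms of index i < j is the
    conditional mean of term j given the first i + 1 coins; this is small by
    hypothesis, whatever those coins are. *)
Lemma coin_mean_sqr_sum (h : nat -> nat -> bool -> R) (c : nat -> R) (B D : R) n :
  (forall i a b, `|h i a b - c i| <= B) ->
  (forall i a m, `|coin_mean m (fun s => alpha * h i (a + count id s)%N true +
      (1 - alpha) * h i (a + count id s)%N false) - c i| <=
      D / Num.sqrt m.+1%:R) ->
  coin_mean n (fun s => (\sum_(0 <= i < n)
     (h i (count id (take i s)) (nth false s i) - c i)) ^+ 2) <=
  (B ^+ 2 + 4 * B * D) * (n%:R * Num.sqrt n%:R).
Proof.
move=> hB hD; have /andP[a0 a1] := alpha01.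
have B0 : 0 <= B by rewrite (le_trans _ (hB 0%N 0%N true)).
have D0 : 0 <= D.
  by have := le_trans (normr_ge0 _) (hD 0%N 0%N 0%N); rewrite sqrtr1 divr1.
pose Y i (s : seq bool) := h i (count id (take i s)) (nth false s i) - c i.
elim: n => [|n IHn].
  by rewrite (@eq_coin_mean _ _ _ _ (fun=> 0)) ?coin_mean_cst ?mul0r ?mulr0//
     => s _; rewrite big_nil expr0n.
rewrite coin_mean_rcons.
pose V s := \sum_(0 <= i < n) Y i s.
pose g (u : seq bool) := alpha * h n (count id u) true +
  (1 - alpha) * h n (count id u) false - c n.
have cov i : (i < n)%N ->
    coin_mean n (fun u => 2 * (Y i u * g u)) <=
    2 * (B * (D / Num.sqrt (n - i.+1).+1%:R)).
  move=> ltin; rewrite coin_meanZ ler_pM2l//.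
  rewrite -{1}(subnKC ltin) coin_mean_cat.
  rewrite -[leRHS](coin_mean_cst alpha i.+1); apply: ler_coin_mean => // u su.
  rewrite (@eq_coin_mean _ _ _ _ (fun v => Y i u *
    (alpha * h n (count id u + count id v)%N true +
    (1 - alpha) * h n (count id u + count id v)%N false - c n))); last first.
    by move=> v _; rewrite /g count_cat /Y nth_cat take_cat su ltnSn.
  rewrite coin_meanZ (le_trans (ler_norm _))// normrM ler_pM ?hB//.
  by rewrite coin_meanB coin_mean_cst hD.
rewrite (@le_trans _ _ (coin_mean n (fun u => V u ^+ 2 +
   (\sum_(0 <= i < n) 2 * (Y i u * g u)) + B ^+ 2)))//.
  apply: ler_coin_mean => // u su.
  rewrite !big_nat_recr//=.
  have Vr b : \sum_(0 <= i < n) (h i (count id (take i (rcons u b)))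
      (nth false (rcons u b) i) - c i) = V u.
    apply: eq_big_nat => i /andP[_ ltin].
    by rewrite /Y nth_rcons su ltin -cats1 take_cat su ltin.
  have tk b : take n (rcons u b) = u by rewrite -cats1 -su take_size_cat.
  have nt b : nth false (rcons u b) n = b by rewrite nth_rcons su ltnn eqxx.
  rewrite !Vr !tk !nt -mulr_sumr -mulr_suml -/(V u).
  set x := h n _ true; set y := h n _ false.
  have x2 : (x - c n) ^+ 2 <= B ^+ 2.
    by rewrite -[leLHS]real_normK ?num_real// lerXn2r ?nnegrE ?hB.
  have y2 : (y - c n) ^+ 2 <= B ^+ 2.
    by rewrite -[leLHS]real_normK ?num_real// lerXn2r ?nnegrE ?hB.
  rewrite /g -/x -/y; nra.
rewrite !coin_meanD coin_mean_cst coin_mean_sum.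
have S : \sum_(0 <= i < n) coin_mean n (fun u => 2 * (Y i u * g u)) <=
    4 * B * D * Num.sqrt n%:R.
  apply: (@le_trans _ _ (\sum_(0 <= i < n) 2 * B * D / Num.sqrt (n - i.+1).+1%:R)).
    apply: ler_sum_nat => i /andP[_ ltin]; apply: le_trans (cov i ltin) _.
    by rewrite !mulrA.
  rewrite -mulr_sumr.
  have -> : \sum_(0 <= i < n) (Num.sqrt (n - i.+1).+1%:R)^-1 =
     \sum_(0 <= i < n) (Num.sqrt i.+1%:R)^-1 :> R.
    by rewrite [RHS]big_nat_rev; apply: eq_bigr => i _; rewrite add0n.
  have -> : 4 * B * D * Num.sqrt n%:R = 2 * B * D * (2 * Num.sqrt n%:R) by ring.
  by rewrite ler_wpM2l ?sum_inv_sqrt// !mulr_ge0.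
apply: le_trans (lerD (lerD IHn S) (lexx _)) _.
set x := Num.sqrt n%:R; set y := Num.sqrt n.+1%:R.
have xy : x <= y by rewrite ler_wsqrtr// ler_nat.
have y1 : 1 <= y by rewrite -[leLHS]sqrtr1 ler_wsqrtr// ler1n.
have n0 : 0 <= n%:R :> R by [].
have E0 : 0 <= 4 * B * D by rewrite !mulr_ge0.
have B2 : 0 <= B ^+ 2 by rewrite sqr_ge0.
rewrite -(natr1 n); move: B2 E0; move: (B ^+ 2) (4 * B * D) => b e b0 e0.
have nxy : n%:R * x <= n%:R * y by rewrite ler_wpM2l.
have : (b + e) * (n%:R * x) <= (b + e) * (n%:R * y).
  by rewrite ler_wpM2l// addr_ge0.
have : b <= b * y by rewrite ler_peMr.
have : e * x <= e * y by rewrite ler_wpM2l.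
nra.
Qed.

End heads_count.

(** * Counting the residues that survive the sieve *)

Section sieve.
Context (R : realType) (k : nat).
Implicit Types (M a i P Q : nat) (b : bool).

Definition sieve M a i : bool :=
  all (fun p => prime p ==> ~~ ((p ^ k %| a) && (p ^ k %| i)))%N (iota 0 M).

(** Here b is the coin of the step that leads from time i to time i + 1. *)
Definition sieve_step M i a b : bool := sieve M a i && sieve M (a + b) i.+1.

Definition sieve_period M : nat := (\prod_(0 <= p < M | prime p) p ^ k)%N.

Definition local_step P i a b : bool :=
  ~~ ((P %| a) && (P %| i))%N && ~~ ((P %| a + b) && (P %| i.+1))%N.

Lemma sieve_stepS M i a b : sieve_step M.+1 i a b =
  sieve_step M i a b && (prime M ==> local_step (M ^ k) i a b).
Proof.
rewrite /sieve_step /sieve /local_step -addn1 iotaD !all_cat /= !andbT add0n.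
by rewrite andbACA; case: (prime M).
Qed.

Lemma sieve_periodS M : sieve_period M.+1 =
  if prime M then (sieve_period M * M ^ k)%N else sieve_period M.
Proof.
rewrite /sieve_period big_mkcond big_nat_recr//= -big_mkcond.
by case: ifP; rewrite ?muln1.
Qed.

Lemma sieve_period_gt0 M : (0 < sieve_period M)%N.
Proof. by apply: prodn_cond_gt0 => p pp; rewrite expn_gt0 prime_gt0. Qed.

Lemma dvdn_sieve_period M p : prime p -> (p < M)%N -> (p ^ k %| sieve_period M)%N.
Proof.
move=> pp; elim: M => [//|M IHM]; rewrite ltnS leq_eqVlt sieve_periodS.
case/predU1P => [<-|/IHM]; first by rewrite pp dvdn_mull.
by case: ifP => // _ /dvdn_trans; apply; rewrite dvdn_mulr.
Qed.

Lemma coprime_sieve_period M : prime M -> coprime (sieve_period M) (M ^ k).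
Proof.
move=> pM; rewrite /sieve_period big_nat_cond.
apply: (big_ind (fun x => coprime x (M ^ k))) => [|x y|p]; first exact: coprime1n.
  by rewrite coprimeMl => -> ->.
case/andP => /andP[_ pltM] pp; apply: coprimeXl; apply: coprimeXr.
by rewrite prime_coprime// dvdn_prime2// ltn_eqF.
Qed.

Lemma sieve_modn M a i :
  sieve M (a %% sieve_period M) (i %% sieve_period M) = sieve M a i.
Proof.
apply: eq_in_all => p; rewrite mem_iota add0n => pltM.
case pp: (prime p) => //=.
by rewrite /dvdn !modn_dvdm// dvdn_sieve_period.
Qed.

Lemma eq_sieve_mod M a i a' i' : (a = a' %[mod sieve_period M])%N ->
  (i = i' %[mod sieve_period M])%N -> sieve M a i = sieve M a' i'.
Proof. by rewrite -sieve_modn => -> ->; rewrite sieve_modn. Qed.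

Lemma eq_sieve_step_mod M i a b i' a' : (a = a' %[mod sieve_period M])%N ->
  (i = i' %[mod sieve_period M])%N -> sieve_step M i a b = sieve_step M i' a' b.
Proof.
move=> aa' ii'; congr (_ && _); apply: eq_sieve_mod => //.
  by rewrite -modnDml aa' modnDml.
by rewrite -(addn1 i) -(addn1 i') -modnDml ii' modnDml.
Qed.

Lemma eq_local_step_mod P i a b i' a' : (a = a' %[mod P])%N ->
  (i = i' %[mod P])%N -> local_step P i a b = local_step P i' a' b.
Proof.
move=> aa' ii'; rewrite /local_step /dvdn aa' ii'.
by rewrite -(modnDml a) aa' modnDml -(addn1 i) -(modnDml i) ii' modnDml addn1.
Qed.

(** The Chinese remainder theorem, as a change of variables in sums. *)
Lemma sum_chinese m n (F : nat -> nat -> R) : (0 < m)%N -> (0 < n)%N ->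
  coprime m n ->
  \sum_(0 <= x < m * n) F (x %% m)%N (x %% n)%N =
  \sum_(0 <= u < m) \sum_(0 <= v < n) F u v.
Proof.
move=> m0 n0 cmn; rewrite !big_mkord.
under [RHS]eq_bigr do rewrite big_mkord.
rewrite pair_big /=.
pose r (x : 'I_(m * n)) : 'I_m * 'I_n :=
  (Ordinal (ltn_pmod x m0), Ordinal (ltn_pmod x n0)).
have rinj : injective r.
  move=> x y [/eqP xm /eqP xn]; apply/val_inj/eqP.
  have := chinese_remainder cmn x y; rewrite xm xn /=.
  by rewrite !modn_small// => ->.
have rbij : bijective r.
  by apply: inj_card_bij => //; rewrite card_prod !card_ord.
by rewrite (reindex r)//; apply: onW_bij.
Qed.

Lemma sum_dvdn d a : (0 < d)%N ->
  \sum_(0 <= t < d) (d %| a + t)%N%:R = 1 :> R.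
Proof.
move=> d0; rewrite (@sum_period_shift _ d (fun t => (d %| t)%N%:R)); last first.
  by move=> s; rewrite dvdn_addl.
rewrite big_ltn// dvdn0 big_nat big1 ?addr0// => t /andP[t0 td].
by rewrite gtnNdvd.
Qed.

(** Exactly two pairs (a, i) modulo P fail, namely (0, 0) and (- b, - 1), and
    they differ since P cannot divide both i and i + 1. *)
Lemma sum_local_step P b : (1 < P)%N ->
  \sum_(0 <= i < P) \sum_(0 <= a < P) (local_step P i a b)%:R =
  P%:R ^+ 2 - 2 :> R.
Proof.
move=> P1; have P0 : (0 < P)%N by rewrite ltnW.
have E i a : (local_step P i a b)%:R = 1 - (P %| a)%N%:R * (P %| i)%N%:R
    - (P %| b + a)%N%:R * (P %| 1 + i)%N%:R :> R.
  rewrite /local_step add1n addnC; have : ~~ ((P %| i) && (P %| i.+1))%N.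
    apply/negP => /andP[Pi]; rewrite -addn1 dvdn_addr// dvdn1 => /eqP P_1.
    by rewrite P_1 in P1.
  case: (P %| a)%N (P %| i)%N (P %| b + a)%N (P %| i.+1)%N => -[] [] [] //= _;
  rewrite ?(mulr0, mul0r, mulr1, subr0, subrr)//.
under eq_bigr do under eq_bigr do rewrite E.
under eq_bigr => i _.
  rewrite !sumrB -!mulr_suml sumr_const_nat subn0 (@sum_dvdn P b)//.
  rewrite -[X in _ - X * _](@sum_dvdn P 0)// (@sum_dvdn P 0)// !mul1r.
  over.
rewrite !sumrB sumr_const_nat subn0 (@sum_dvdn P 1)//.
rewrite [X in _ - X - _](@sum_dvdn P 0)//.
rewrite -mulrnA mulnn natrX; ring.
Qed.

(** The conditions at different primes are independent modulo the period by the
    Chinese remainder theorem, and each prime p leaves p^(2k) - 2 pairs. *)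
Lemma sum_sieve_step M b : (0 < k)%N ->
  \sum_(0 <= i < sieve_period M) \sum_(0 <= a < sieve_period M)
     (sieve_step M i a b)%:R =
  (sieve_period M)%:R ^+ 2 * euler_partial R k M.
Proof.
move=> k0; elim: M => [|M IHM].
  have -> : sieve_period 0 = 1%N by rewrite /sieve_period big_geq.
  by rewrite /euler_partial (big_geq (leqnn 0)) !big_nat1 expr1n mulr1.
have -> : euler_partial R k M.+1 = euler_partial R k M *
    (if prime M then 1 - 2 / M%:R ^+ (2 * k) else 1).
  by rewrite /euler_partial big_mkcond big_nat_recr//= -big_mkcond.
rewrite sieve_periodS; case: ifP => pM; last first.
  rewrite mulr1 -IHM; apply: eq_bigr => i _; apply: eq_bigr => a _.
  by rewrite sieve_stepS pM andbT.
set Q := sieve_period M; set P := (M ^ k)%N.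
have Q0 : (0 < Q)%N := sieve_period_gt0 M.
have P1 : (1 < P)%N by rewrite -(exp1n k) ltn_exp2r// prime_gt1.
have P0 : (0 < P)%N by rewrite ltnW.
have cQP : coprime Q P by apply: coprime_sieve_period.
pose f u v u' v' : R := (sieve_step M u u' b)%:R * (local_step P v v' b)%:R.
have E i a : (sieve_step M.+1 i a b)%:R =
    f (i %% Q)%N (i %% P)%N (a %% Q)%N (a %% P)%N.
  rewrite sieve_stepS pM /f -(@eq_sieve_step_mod _ i a) ?modn_mod//.
  rewrite -(@eq_local_step_mod _ i a) ?modn_mod//.
  by case: sieve_step; rewrite ?mul1r ?mul0r.
under eq_bigr => i _.
  under eq_bigr do rewrite E.
  rewrite (sum_chinese (f (i %% Q)%N (i %% P)%N))//.
  over.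
rewrite (sum_chinese (fun u v => \sum_(0 <= u' < Q) \sum_(0 <= v' < P) f u v u' v'))//.
transitivity (\sum_(0 <= u < Q) (\sum_(0 <= u' < Q) (sieve_step M u u' b)%:R) *
    (P%:R ^+ 2 - 2) : R).
  apply: eq_bigr => u _; rewrite -(sum_local_step b P1).
  rewrite mulr_sumr; apply: eq_bigr => v _.
  rewrite mulr_suml; apply: eq_bigr => u' _.
  by rewrite mulr_sumr.
rewrite -mulr_suml IHM natrM.
have -> : M%:R ^+ (2 * k) = P%:R ^+ 2 :> R by rewrite natrX -exprM mulnC.
field; by rewrite pnatr_eq0 -lt0n.
Qed.

End sieve.

(** * Sums over divisors *)

Section divisor_sums.
Context (R : realType).

Lemma sum_inv_sqr (a b : nat) : (0 < a)%N ->
  \sum_(a <= d < b) (d%:R ^+ 2)^-1 <= 2 / a%:R :> R.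
Proof.
move=> a0; have [ba|/ltnW ab] := leqP b a.
  by rewrite big_geq// divr_ge0.
(* The telescoping bound 1 / x^2 <= 2 / x - 2 / (x + 1) for x >= 1. *)
apply: (@le_trans _ _ (2 / a%:R - 2 / b%:R)); last first.
  by rewrite lerBlDr lerDl divr_ge0.
rewrite -(subnKC ab); elim: (b - a)%N => [|j IHj].
  by rewrite addn0 big_geq// subrr.
rewrite addnS big_nat_recr ?leq_addr//=.
apply: le_trans (lerD IHj (lexx _)) _.
rewrite -addrA lerD2l -(natr1 (a + j)).
have : 1 <= (a + j)%:R :> R by rewrite ler1n addn_gt0 a0.
set x := (a + j)%:R => x1; rewrite addrC lerBlDr.
have -> : - (2 / (x + 1)) + 2 / x = (x ^+ 2)^-1 + (x - 1) / (x ^+ 2 * (x + 1)).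
  by field; rewrite !gt_eqF//; lra.
by rewrite lerDl divr_ge0// ?mulr_ge0 ?sqr_ge0//; lra.
Qed.

(** A logarithm would be the true order; any power of n below 1/2 is enough for
    the bound on large divisors, and the fourth root needs only an algebraic
    identity. *)
Lemma sum_inv_nat n :
  \sum_(0 <= i < n) (i.+1%:R)^-1 <= 4 * Num.sqrt (Num.sqrt n%:R) :> R.
Proof.
elim: n => [|n IHn]; first by rewrite big_geq// mulr_ge0// sqrtr_ge0.
rewrite big_nat_recr//=; apply: le_trans (lerD IHn (lexx _)) _.
have s4 m : Num.sqrt (Num.sqrt m%:R) ^+ 4 = m%:R :> R.
  by rewrite (exprM _ 2 2) !sqr_sqrtr ?sqrtr_ge0.
set x := Num.sqrt (Num.sqrt n%:R); set y := Num.sqrt (Num.sqrt n.+1%:R).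
have x0 : 0 <= x by rewrite sqrtr_ge0.
have y1 : 1 <= y.
  by rewrite -[leLHS]sqrtr1 ler_wsqrtr// -[leLHS]sqrtr1 ler_wsqrtr// ler1n.
have xy : x <= y by rewrite !ler_wsqrtr// ler_nat.
have y4 : y ^+ 4 = n.+1%:R by rewrite s4.
have y4x : y ^+ 4 = x ^+ 4 + 1 by rewrite y4 s4 natr1.
rewrite -y4 -lerBrDl -mulrBr -[leLHS]mul1r ler_pdivrMr ?exprn_gt0//; last by lra.
have e : (y - x) * ((y + x) * (y ^+ 2 + x ^+ 2)) = 1.
  by transitivity (y ^+ 4 - x ^+ 4); [ring | rewrite y4x; ring].
rewrite -[leLHS]e (mulrC 4) -mulrA ler_wpM2l ?subr_ge0//.
have xy2 : x ^+ 2 <= y ^+ 2 by rewrite lerXn2r ?nnegrE//; lra.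
have y34 : y ^+ 3 <= y ^+ 4 by rewrite ler_weXn2l.
apply: (@le_trans _ _ ((y + y) * (y ^+ 2 + y ^+ 2))).
  by apply: ler_pM; rewrite ?addr_ge0 ?sqr_ge0 ?lerD2l//; lra.
have -> : (y + y) * (y ^+ 2 + y ^+ 2) = 4 * y ^+ 3 by ring.
by rewrite ler_pM2l.
Qed.

Lemma sum_multiples d n : (0 < d)%N ->
  \sum_(0 <= i < n) ((0 < i) && (d %| i))%N%:R <= n%:R / d%:R :> R.
Proof.
move=> d0; apply: (@le_trans _ _ (n %/ d)%N%:R); last first.
  by rewrite ler_pdivlMr ?ltr0n// -natrM ler_nat leq_trunc_div.
case: n => [|n]; first by rewrite big_geq.
have -> : \sum_(0 <= i < n.+1) ((0 < i) && (d %| i))%N%:R = (n %/ d)%N%:R :> R.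
  elim: n => [|n IHn]; first by rewrite big_nat1 div0n.
  by rewrite big_nat_recr//= IHn divnS// natrD addrC.
by rewrite ler_nat leq_div2r.
Qed.

Lemma sum_multiples_inv_sqrt d n : (0 < d)%N ->
  \sum_(0 <= i < n) ((0 < i) && (d %| i))%N%:R / Num.sqrt i.+1%:R <=
  2 * Num.sqrt n%:R / d%:R :> R.
Proof.
move=> d0; have sd0 : 0 < Num.sqrt d%:R :> R by rewrite sqrtr_gt0 ltr0n.
have sdd : Num.sqrt d%:R ^+ 2 = d%:R :> R by rewrite sqr_sqrtr.
case: n => [|n]; first by rewrite big_geq// divr_ge0// mulr_ge0// sqrtr_ge0.
apply: (@le_trans _ _ (2 * Num.sqrt (n %/ d)%N%:R / Num.sqrt d%:R)); last first.
  rewrite -[in leRHS]sdd.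
  have -> x : 2 * x / Num.sqrt d%:R = 2 * (x * Num.sqrt d%:R) / Num.sqrt d%:R ^+ 2 :> R.
    by field; rewrite gt_eqF.
  rewrite ler_wpM2r ?invr_ge0 ?sqr_ge0// ler_pM2l// -sqrtrM// ler_wsqrtr//.
  by rewrite -natrM ler_nat (leq_trans (leq_trunc_div _ _)).
elim: n => [|n IHn].
  by rewrite big_nat1 mul0r divr_ge0// mulr_ge0// sqrtr_ge0.
rewrite big_nat_recr//=; apply: le_trans (lerD IHn (lexx _)) _.
rewrite divnS//; case: (boolP (d %| n.+1)%N) => [dn|_]; last first.
  by rewrite mul0r addr0 add0n.
rewrite add1n -lerBrDl -mulrBl -mulrBr ler_pdivlMr// mul1r.
set q := (n %/ d)%N.
have nq : n.+1 = (q.+1 * d)%N.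
  by rewrite -[LHS](divnK dn) divnS// dn.
set x := Num.sqrt q%:R; set y := Num.sqrt q.+1%:R.
have y0 : 0 < y by rewrite sqrtr_gt0 ltr0n.
apply: (@le_trans _ _ y^-1).
  have yd : y * Num.sqrt d%:R <= Num.sqrt n.+2%:R.
    by rewrite -sqrtrM// ler_wsqrtr// -natrM -nq ler_nat.
  by rewrite ler_pdivrMl ?(lt_le_trans _ yd) ?mulr_gt0// ler_pdivlMr// mulrC.
have yy : y ^+ 2 = x ^+ 2 + 1 by rewrite !sqr_sqrtr ?ler0n// natr1.
rewrite -(ler_pM2r y0) mulVf ?gt_eqF//.
have := sqr_ge0 (y - x); nra.
Qed.

End divisor_sums.

(** * Moments of the divisor counts and of the sieve along the walk *)

Section walk_divisors.
Context (R : realType) (alpha : R).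
Hypothesis alpha01 : 0 < alpha < 1.
Local Notation coin_mean := (coin_mean alpha).
Local Notation kappa := (smooth_const alpha).

Definition heads i (s : seq bool) : nat := count id (take i s).

Lemma coin_mean_dvdn n d a : (0 < d)%N ->
  `|coin_mean n (fun s => (d %| a + count id s)%N%:R) - d%:R^-1| <=
  2 * kappa / Num.sqrt n.+1%:R.
Proof.
move=> d0; pose f t : R := (d %| t)%N%:R.
have fd s : f (s + d)%N = f s by rewrite /f dvdn_addl.
have fm : period_mean d f = d%:R^-1.
  by rewrite /period_mean (@sum_dvdn R d 0)// div1r.
have := coin_mean_periodic alpha01 n a d0 fd; rewrite fm => /le_trans; apply.
rewrite ler_wpM2r ?invr_ge0 ?sqrtr_ge0// ler_wpM2r ?(ltW (smooth_const_gt0 alpha01))//.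
apply: (@le_trans _ _ (\sum_(0 <= t < d) (f t + d%:R^-1))).
  apply: ler_sum => t _; apply: le_trans (ler_normB _ _) _.
  by rewrite !ger0_norm.
rewrite big_split/= (@sum_dvdn R d 0)// sumr_const_nat subn0.
rewrite -(mulr_natr d%:R^-1) mulVf//.
by rewrite pnatr_eq0 -lt0n.
Qed.

Lemma coin_mean_take n i (g : seq bool -> R) : (i <= n)%N ->
  coin_mean n (fun s => g (take i s)) = coin_mean i g.
Proof.
move=> lein; rewrite -(subnKC lein) coin_mean_cat; apply: eq_coin_mean => u su.
rewrite -[RHS](coin_mean_cst alpha (n - i)%N); apply: eq_coin_mean => v _.
by rewrite -su take_size_cat.
Qed.

(** Time 0 is excluded because the walk then sits at the origin, whose
    coordinates every integer divides. *)
Definition common_divisors lo hi i a : R :=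
  \sum_(lo <= d < hi) ((0 < i) && (d %| i) && (d %| a))%N%:R.

(** The mean of common_divisors if a were uniform modulo each d. *)
Definition expected_divisors lo hi i : R :=
  \sum_(lo <= d < hi) ((0 < i) && (d %| i))%N%:R / d%:R.

Lemma coin_mean_common_divisors lo hi i a n : (0 < lo)%N ->
  `|coin_mean n (fun s => common_divisors lo hi i (a + count id s)%N) -
    expected_divisors lo hi i| <= (hi%:R * (2 * kappa)) / Num.sqrt n.+1%:R.
Proof.
move=> lo0; rewrite coin_mean_sum /expected_divisors -sumrB.
apply: le_trans (ler_norm_sum _ _ _) _.
apply: (@le_trans _ _ (\sum_(lo <= d < hi) (2 * kappa / Num.sqrt n.+1%:R))).
  apply: ler_sum_nat => d /andP[lod _]; have d0 := leq_trans lo0 lod.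
  case: ((0 < i)%N && (d %| i)%N) => /=.
    by rewrite mul1r coin_mean_dvdn.
  rewrite coin_mean_cst mul0r subrr normr0 divr_ge0 ?sqrtr_ge0//.
  by rewrite mulr_ge0// ltW// smooth_const_gt0.
rewrite sumr_const_nat -(mulr_natr (_ / _)) mulrC -[leRHS]mulrA ler_wpM2r//.
  by rewrite divr_ge0 ?sqrtr_ge0// mulr_ge0// ltW// smooth_const_gt0.
by rewrite ler_nat leq_subr.
Qed.

Lemma sum_expected_divisors lo hi n : (0 < lo)%N ->
  \sum_(0 <= i < n) expected_divisors lo hi i <= 2 * n%:R / lo%:R.
Proof.
move=> lo0; rewrite exchange_big_nat/=.
apply: (@le_trans _ _ (\sum_(lo <= d < hi) n%:R * (d%:R ^+ 2)^-1)).
  apply: ler_sum_nat => d /andP[lod _]; have d0 := leq_trans lo0 lod.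
  rewrite -mulr_suml expr2 invfM mulrA ler_wpM2r ?invr_ge0//.
  exact: sum_multiples.
rewrite -mulr_sumr (mulrC 2) -mulrA ler_wpM2l//.
exact: sum_inv_sqr.
Qed.

(** Serves for hi a small power of n, so that the bound is o(n^2) and the sum
    stays near its mean on the scale n. *)
Lemma coin_mean_sqr_common_divisors lo hi n : (0 < lo)%N ->
  coin_mean n (fun s => (\sum_(0 <= i < n)
     (common_divisors lo hi i (heads i s) - expected_divisors lo hi i)) ^+ 2) <=
  hi%:R ^+ 2 * (1 + 8 * kappa) * (n%:R * Num.sqrt n%:R).
Proof.
move=> lo0; have -> : hi%:R ^+ 2 * (1 + 8 * kappa) =
   hi%:R ^+ 2 + 4 * hi%:R * (hi%:R * (2 * kappa)) by ring.
apply: (@coin_mean_sqr_sum R alpha alpha01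
  (fun i a _ => common_divisors lo hi i a)) => [i a b|i a m].
  rewrite /common_divisors /expected_divisors -sumrB.
  apply: le_trans (ler_norm_sum _ _ _) _.
  apply: (@le_trans _ _ (\sum_(lo <= d < hi) 1)); last first.
    by rewrite sumr_const_nat ler_nat leq_subr.
  apply: ler_sum_nat => d /andP[lod _]; have d0 := leq_trans lo0 lod.
  have d1 : 0 <= (d%:R^-1 : R) <= 1.
    by rewrite invr_ge0 ler0n invf_le1 ?ltr0n ?ler1n.
  rewrite ler_norml; case: ((0 < i)%N && (d %| i)%N) (d %| a)%N => -[]/=;
  by rewrite ?mul1r ?mul0r; lra.
have e s : alpha * common_divisors lo hi i (a + count id s)%N +
    (1 - alpha) * common_divisors lo hi i (a + count id s)%N =
    common_divisors lo hi i (a + count id s)%N by ring.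
under eq_coin_mean do rewrite e.
exact: coin_mean_common_divisors.
Qed.

(** Serves for the divisors too large for a second moment: with lo growing like
    a power of n, already the mean is a power of n smaller than n. *)
Lemma coin_mean_sum_common_divisors lo n : (0 < lo)%N ->
  coin_mean n (fun s => \sum_(0 <= i < n) common_divisors lo n i (heads i s)) <=
  2 * n%:R / lo%:R + 16 * kappa * (Num.sqrt n%:R * Num.sqrt (Num.sqrt n%:R)).
Proof.
move=> lo0; have k0 : 0 < kappa := smooth_const_gt0 alpha01.
rewrite coin_mean_sum.
pose e i d : R := ((0 < i) && (d %| i))%N%:R / Num.sqrt i.+1%:R.
apply: (@le_trans _ _ (\sum_(0 <= i < n) (expected_divisors lo n i +
    2 * kappa * \sum_(lo <= d < n) e i d))).
  apply: ler_sum_nat => i /andP[_ ltin].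
  rewrite (coin_mean_take (fun u => common_divisors lo n i (count id u)) (ltnW ltin)).
  rewrite coin_mean_sum mulr_sumr -big_split/=.
  apply: ler_sum_nat => d /andP[lod _]; have d0 := leq_trans lo0 lod.
  rewrite /e; case: ((0 < i)%N && (d %| i)%N) => /=; last first.
    by rewrite coin_mean_cst !mul0r mulr0 addr0.
  have := coin_mean_dvdn i 0 d0.
  rewrite ler_distl => /andP[_]; by rewrite !mul1r.
rewrite big_split/= lerD ?sum_expected_divisors// -mulr_sumr exchange_big_nat/=.
apply: (@le_trans _ _ (2 * kappa * (\sum_(lo <= d < n) 2 * Num.sqrt n%:R * d%:R^-1))).
  rewrite ler_pM2l ?mulr_gt0//; apply: ler_sum_nat => d /andP[lod _].
  exact: sum_multiples_inv_sqrt (leq_trans lo0 lod).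
rewrite -mulr_sumr.
have -> : 16 * kappa * (Num.sqrt n%:R * Num.sqrt (Num.sqrt n%:R)) =
  2 * kappa * (2 * Num.sqrt n%:R * (4 * Num.sqrt (Num.sqrt n%:R))) by ring.
rewrite ler_pM2l ?mulr_gt0// ler_wpM2l ?mulr_ge0 ?sqrtr_ge0//.
apply: le_trans (sum_inv_nat R n).
have [nlo|/ltnW lon] := leqP n lo; first by rewrite big_geq// sumr_ge0.
have -> : \sum_(lo <= d < n) d%:R^-1 = \sum_(lo.-1 <= i < n.-1) i.+1%:R^-1 :> R.
  by rewrite -{1}(prednK lo0) -{1}(prednK (leq_trans lo0 lon)) big_add1.
rewrite [leRHS](@big_cat_nat _ _ _ lo.-1) ?(leq_trans (leq_pred _))//=.
rewrite [X in _ + X](@big_cat_nat _ _ _ n.-1) ?leq_pred//=; last first.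
  by rewrite -ltnS !prednK// (leq_trans lo0).
by rewrite addrCA lerDl addr_ge0// sumr_ge0.
Qed.

End walk_divisors.

Section sieve_deviation.
Context (R : realType) (alpha : R) (k : nat).
Hypothesis alpha01 : 0 < alpha < 1.
Local Notation coin_mean := (coin_mean alpha).
Local Notation kappa := (smooth_const alpha).

(** The conditional probability that the step from time i survives the sieve,
    given that the heads count at time i is a. *)
Definition step_density M i a : R :=
  alpha * (sieve_step k M i a true)%:R + (1 - alpha) * (sieve_step k M i a false)%:R.

Definition step_mean M i : R := period_mean (sieve_period k M) (step_density M i).

Lemma step_densityD M i a :
  step_density M i (a + sieve_period k M)%N = step_density M i a.
Proof.
by rewrite /step_density !(@eq_sieve_step_mod k M i (a + _)%N _ i a) ?modnDr.
Qed.

Lemma step_meanD M i : step_mean M (i + sieve_period k M)%N = step_mean M i.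
Proof.
rewrite /step_mean /step_density; congr (_ / _); apply: eq_bigr => a _.
by rewrite !(@eq_sieve_step_mod k M (i + _)%N a _ i a) ?modnDr.
Qed.

Lemma period_mean_step_mean M : (0 < k)%N ->
  period_mean (sieve_period k M) (step_mean M) = euler_partial R k M.
Proof.
move=> k0; rewrite /period_mean /step_mean /period_mean -mulr_suml.
under eq_bigr => i _ do rewrite big_split/= -!mulr_sumr.
rewrite big_split/= -!mulr_sumr !sum_sieve_step//.
by field; rewrite pnatr_eq0 -lt0n sieve_period_gt0.
Qed.

Lemma step_density_itv M i a : 0 <= step_density M i a <= 1.
Proof.
have /andP[a0 a1] := alpha01; rewrite /step_density.
by case: sieve_step; case: sieve_step; rewrite ?(mulr1, mulr0); lra.
Qed.

Lemma step_mean_itv M i : 0 <= step_mean M i <= 1.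
Proof.
exact: period_mean_itv (sieve_period_gt0 k M) (step_density_itv M i).
Qed.

Lemma coin_mean_sqr_sieve_step M n :
  coin_mean n (fun s => (\sum_(0 <= i < n)
     ((sieve_step k M i (heads i s) (nth false s i))%:R - step_mean M i)) ^+ 2) <=
  (1 + 4 * (sieve_period k M)%:R * kappa) * (n%:R * Num.sqrt n%:R).
Proof.
have -> : 1 + 4 * (sieve_period k M)%:R * kappa =
  1 ^+ 2 + 4 * 1 * ((sieve_period k M)%:R * kappa) by ring.
apply: (@coin_mean_sqr_sum R alpha alpha01
  (fun i a b => (sieve_step k M i a b)%:R)) => [i a b|i a m].
  by have := step_mean_itv M i; rewrite ler_norml; case: sieve_step => /=; lra.
have Q0 := sieve_period_gt0 k M.
have := coin_mean_periodic alpha01 m a Q0 (step_densityD M i).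
move=> /le_trans; apply; rewrite ler_wpM2r ?invr_ge0 ?sqrtr_ge0//.
rewrite ler_wpM2r ?(ltW (smooth_const_gt0 alpha01))//.
exact: ler_sum_period_dev (step_density_itv M i).
Qed.

End sieve_deviation.

(** * Atypical coin sequences are rare *)

Section bad_event.
Context (R : realType) (alpha : R) (k : nat).
Hypothesis alpha01 : 0 < alpha < 1.
Local Notation coin_mean := (coin_mean alpha).
Local Notation kappa := (smooth_const alpha).

Definition sieve_dev M (s : seq bool) : R := \sum_(0 <= i < size s)
  ((sieve_step k M i (heads i s) (nth false s i))%:R - step_mean alpha k M i).

Definition divisors_dev M z (s : seq bool) : R := \sum_(0 <= i < size s)
  (common_divisors R M z i (heads i s) - expected_divisors R M z i).

Definition large_divisors z (s : seq bool) : R :=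
  \sum_(0 <= i < size s) common_divisors R z (size s) i (heads i s).

Definition atypical M z (s : seq bool) : bool :=
  [|| (size s)%:R / M%:R < `|sieve_dev M s|,
      (size s)%:R / M%:R < `|divisors_dev M z s| |
      (size s)%:R / M%:R < large_divisors z s].

Lemma common_divisors_ge0 lo hi i a : 0 <= common_divisors R lo hi i a.
Proof. exact: sumr_ge0. Qed.

(** At time n = m^12 with threshold z = m^2, Chebyshev's inequality bounds the
    deviation of the sieve by O(n^(-1/2)) = O(m^(-6)) and that of the divisors
    below z by O(z^2 n^(-1/2)) = O(m^(-2)), while Markov's inequality bounds
    the divisors from z on by O(1 / z + n^(-1/4)) = O(m^(-2)). *)
Lemma coin_mean_atypical M : (0 < M)%N -> exists C : R, 0 <= C /\
  forall m, (0 < m)%N ->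
  coin_mean (m ^ 12) (fun s => (atypical M (m ^ 2) s)%:R) <= C / m%:R ^+ 2.
Proof.
move=> M0; have k0 : 0 < kappa := smooth_const_gt0 alpha01.
pose Q : R := (sieve_period k M)%:R.
have Q0 : 0 <= Q by [].
have M0R : 0 < M%:R :> R by rewrite ltr0n.
exists ((1 + 4 * Q * kappa) * M%:R ^+ 2 + (1 + 8 * kappa) * M%:R ^+ 2 +
  M%:R * (2 + 16 * kappa)).
have c1 : 0 <= (1 + 4 * Q * kappa) * M%:R ^+ 2.
  by rewrite mulr_ge0 ?sqr_ge0// addr_ge0// !mulr_ge0// ltW.
have c2 : 0 <= (1 + 8 * kappa) * M%:R ^+ 2.
  by rewrite mulr_ge0 ?sqr_ge0// addr_ge0// !mulr_ge0// ltW.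
have c3 : 0 <= M%:R * (2 + 16 * kappa).
  by rewrite mulr_ge0// addr_ge0// !mulr_ge0// ltW.
split=> [|m m0]; first by rewrite !addr_ge0.
set n := (m ^ 12)%N; set z := (m ^ 2)%N.
have m1 : 1 <= m%:R :> R by rewrite ler1n.
have mpos : 0 < m%:R :> R by rewrite ltr0n.
have sq : Num.sqrt n%:R = m%:R ^+ 6 :> R.
  by rewrite /n natrX (exprM _ 6 2) sqrtr_sqr ger0_norm ?exprn_ge0.
have sq2 : Num.sqrt (m%:R ^+ 6) = m%:R ^+ 3 :> R.
  by rewrite (exprM _ 3 2) sqrtr_sqr ger0_norm ?exprn_ge0.
have nR : n%:R = m%:R ^+ 12 :> R by rewrite /n natrX.
have zR : z%:R = m%:R ^+ 2 :> R by rewrite /z natrX.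
have lambda0 : 0 < n%:R / M%:R :> R by rewrite divr_gt0// nR exprn_gt0.
apply: (@le_trans _ _ (coin_mean n (fun s =>
    (n%:R / M%:R < `|sieve_dev M s|)%R%:R +
    (n%:R / M%:R < `|divisors_dev M z s|)%R%:R +
    (n%:R / M%:R < large_divisors z s)%R%:R))).
  apply: ler_coin_mean => // s sn; rewrite /atypical sn.
  by do 3!case: (_ < _); rewrite /= -!natrD ler_nat.
have dist (a b c x : R) : (a + b + c) / x = a / x + b / x + c / x.
  by rewrite !mulrDl.
rewrite !coin_meanD dist !lerD//.
- apply: le_trans (coin_mean_chebyshev alpha01 _ _ lambda0) _.
  rewrite ler_pdivrMr ?exprn_gt0//.
  have -> : coin_mean n (fun s => sieve_dev M s ^+ 2) =
     coin_mean n (fun s => (\sum_(0 <= i < n)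
     ((sieve_step k M i (heads i s) (nth false s i))%:R - step_mean alpha k M i)) ^+ 2).
    by apply: eq_coin_mean => s sn; rewrite /sieve_dev sn.
  apply: le_trans (coin_mean_sqr_sieve_step k alpha01 M n) _.
  rewrite sq nR -/Q.
  have -> : (1 + 4 * Q * kappa) * M%:R ^+ 2 / m%:R ^+ 2 * (m%:R ^+ 12 / M%:R) ^+ 2 =
    (1 + 4 * Q * kappa) * m%:R ^+ 22.
    by field; rewrite !gt_eqF.
  rewrite ler_wpM2l//; last by rewrite -exprD ler_weXn2l.
  by rewrite addr_ge0// !mulr_ge0// ltW.
- apply: le_trans (coin_mean_chebyshev alpha01 _ _ lambda0) _.
  rewrite ler_pdivrMr ?exprn_gt0//.
  have -> : coin_mean n (fun s => divisors_dev M z s ^+ 2) =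
     coin_mean n (fun s => (\sum_(0 <= i < n)
     (common_divisors R M z i (heads i s) - expected_divisors R M z i)) ^+ 2).
    by apply: eq_coin_mean => s sn; rewrite /divisors_dev sn.
  apply: le_trans (coin_mean_sqr_common_divisors alpha01 z n M0) _.
  rewrite sq nR zR le_eqVlt; apply/orP; left; apply/eqP.
  by field; rewrite !gt_eqF.
- have L0 s : 0 <= large_divisors z s.
    by apply: sumr_ge0 => i _; exact: common_divisors_ge0.
  apply: le_trans (coin_mean_markov alpha01 (f := large_divisors z) lambda0 _) _ => //.
  rewrite ler_pdivrMr//.
  have -> : coin_mean n (large_divisors z) = coin_mean n (fun s =>
     \sum_(0 <= i < n) common_divisors R z n i (heads i s)).
    by apply: eq_coin_mean => s sn; rewrite /large_divisors sn.
  have z0 : (0 < z)%N by rewrite expn_gt0 m0.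
  apply: le_trans (coin_mean_sum_common_divisors alpha01 n z0) _.
  rewrite sq sq2 nR zR.
  have -> : M%:R * (2 + 16 * kappa) / m%:R ^+ 2 * (m%:R ^+ 12 / M%:R) =
    2 * m%:R ^+ 10 + 16 * kappa * m%:R ^+ 10.
    by field; rewrite !gt_eqF.
  apply: lerD.
    by rewrite le_eqVlt; apply/orP; left; apply/eqP; field; rewrite !gt_eqF.
  by rewrite -exprD ler_wpM2l// ?mulr_ge0 ?(ltW k0)// ler_weXn2l.
Qed.

End bad_event.

(** * From typical coin sequences to the k-free average *)

Section kfree_sieve.
Context (R : realType) (k : nat).

Lemma kfree_gcdnP a i : (0 < i)%N ->
  kfree k (gcdn a i) <-> forall p, prime p -> ~~ ((p ^ k %| a) && (p ^ k %| i))%N.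
Proof.
move=> i0; rewrite /kfree gcdn_gt0 i0 orbT; split=> [[_ K] p pp|K].
  by rewrite -dvdn_gcd K.
by split=> // p pp; rewrite dvdn_gcd K.
Qed.

(** Where the two conditions disagree, a prime p >= M has its k-th power, hence
    p itself, dividing both a and i. *)
Lemma sieve_error M n a i : (0 < k)%N -> (0 < i < n)%N ->
  (`[< kfree k (gcdn a i) >] != sieve k M a i)%:R <= common_divisors R M n i a.
Proof.
move=> k0 /andP[i0 iltn].
have cd0 : 0 <= common_divisors R M n i a := common_divisors_ge0 _ _ _ _ _.
have [K|K] := asboolP (kfree k (gcdn a i)).
  have -> : sieve k M a i = true.
    apply/allP => p _; apply/implyP => pp.
    by have /(kfree_gcdnP a i0)/(_ p pp) := K.
  by rewrite eqxx.
have [S|] /= := boolP (sieve k M a i); last by [].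

have [p [pp /andP[pa pi]]] : exists p, prime p /\ ((p ^ k %| a) && (p ^ k %| i))%N.
  apply: contrapT => N; apply: K; apply/(kfree_gcdnP a i0) => p pp.
  by apply/negP => d; apply: N; exists p.
have pd : (p %| p ^ k)%N by rewrite dvdn_exp.
have Mp : (M <= p)%N.
  rewrite leqNgt; apply/negP => pM; move/allP: S => /(_ p).
  by rewrite mem_iota add0n pM => /(_ isT); rewrite pp pa pi.
have pn : (p < n)%N by rewrite (leq_ltn_trans _ iltn)// dvdn_leq// (dvdn_trans pd).
rewrite /common_divisors (big_cat_nat (n := p)) ?(ltnW pn)//= [X in _ + X]big_ltn//.
rewrite i0 (dvdn_trans pd pi) (dvdn_trans pd pa) /=.
by rewrite addrCA lerDl addr_ge0// sumr_ge0.
Qed.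

End kfree_sieve.

Section comparison.
Context (R : realType) (alpha : R) (k : nat).
Hypothesis alpha01 : 0 < alpha < 1.
Hypothesis k0 : (0 < k)%N.

Definition kfree_at (w : nat -> bool) i : bool :=
  `[< kfree k (gcdn (count id (mkseq w i)) i) >].

Lemma heads_mkseq (w : nat -> bool) i n : (i <= n)%N ->
  heads i (mkseq w n) = count id (mkseq w i).
Proof. by move=> lein; rewrite /heads /mkseq -map_take take_iota (minn_idPl lein). Qed.

Lemma headsS (w : nat -> bool) i :
  count id (mkseq w i.+1) = (count id (mkseq w i) + w i)%N.
Proof. by rewrite mkseqS -cats1 count_cat /= addn0. Qed.

Lemma ler_norm_andb (x y x' y' : bool) :
  `|(x && y)%:R - (x' && y')%:R| <= (x != x')%:R + (y != y')%:R :> R.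
Proof. by case: x y x' y' => -[] [] [] /=; rewrite ler_norml; lra. Qed.

(** Each time i belongs to the steps from i - 1 and from i, hence the factor 2.
    The constant 3 collects the times where common_divisors gives no bound:
    time 0, charged twice, and time n. *)
Lemma sum_kfree_sieve M n (w : nat -> bool) :
  `|\sum_(0 <= i < n) (kfree_at w i && kfree_at w i.+1)%:R -
    \sum_(0 <= i < n) (sieve_step k M i (count id (mkseq w i)) (w i))%:R| <=
  3 + 2 * \sum_(0 <= i < n) common_divisors R M n i (count id (mkseq w i)).
Proof.
pose e i : R := (kfree_at w i != sieve k M (count id (mkseq w i)) i)%:R.
have e01 i : 0 <= e i <= 1 by rewrite /e; case: (_ != _) => /=; lra.
have esum : \sum_(0 <= i < n) e i <=
    1 + \sum_(0 <= i < n) common_divisors R M n i (count id (mkseq w i)).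
  case: n => [|n]; first by rewrite !big_geq// addr0.
  rewrite big_ltn// [X in _ <= 1 + X]big_ltn// addrA lerD//.
    rewrite (le_trans (_ : e 0%N <= 1))// ?lerDl ?common_divisors_ge0//.
    by case/andP: (e01 0%N).
  by apply: ler_sum_nat => i ltin; apply: sieve_error.
have eshift : \sum_(0 <= i < n) e i.+1 <= \sum_(0 <= i < n) e i + 1.
  have : \sum_(0 <= i < n.+1) e i = \sum_(0 <= i < n.+1) e i by [].
  rewrite {1}big_nat_recr//= big_nat_recl//=.
  have := e01 0%N; have := e01 n; lra.
rewrite -sumrB; apply: le_trans (ler_norm_sum _ _ _) _.
apply: (@le_trans _ _ (\sum_(0 <= i < n) (e i + e i.+1))).
  by apply: ler_sum => i _; rewrite /e /sieve_step headsS ler_norm_andb.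
by rewrite big_split/=; lra.
Qed.

(** Up to constants, an error of n / M comes from the deviation of the sieve, one
    of 2 n / M from the mean number of divisors below z, and one of n / M from
    each of the two remaining divisor terms; the divisors count twice because
    each time belongs to two steps. *)
Lemma sum_kfree_typical M m (w : nat -> bool) :
  (0 < M)%N -> (M <= m ^ 2)%N -> (0 < m)%N ->
  ~~ atypical alpha k M (m ^ 2) (mkseq w (m ^ 12)) ->
  `|\sum_(0 <= i < m ^ 12) (kfree_at w i && kfree_at w i.+1)%:R -
    (m ^ 12)%:R * euler_partial R k M| <=
  9 * ((m ^ 12)%:R / M%:R) + (3 + (sieve_period k M)%:R).
Proof.
move=> M0 Mm m0; set n := (m ^ 12)%N; set z := (m ^ 2)%N.
have zn : (z <= n)%N by rewrite /z /n leq_pexp2l.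
rewrite /atypical size_mkseq !negb_or -!leNgt => /and3P[dS dM dL].
set N : R := n%:R / M%:R in dS dM dL *.
have A := sum_kfree_sieve M n w.
set K := \sum_(0 <= i < n) _ in A *; set S := \sum_(0 <= i < n) _ in A.
set D := \sum_(0 <= i < n) _ in A.
have Dle : D <= 4 * N.
  have -> : D = divisors_dev R M z (mkseq w n) +
     \sum_(0 <= i < n) expected_divisors R M z i + large_divisors R z (mkseq w n).
    rewrite /divisors_dev /large_divisors size_mkseq -!big_split/=.
    apply: eq_big_nat => i /andP[_ ltin].
    by rewrite heads_mkseq ?(ltnW ltin)// subrK /common_divisors (big_cat_nat (n := z)).
  have := @sum_expected_divisors R M z n M0; rewrite -mulrA -/N.
  by have := le_trans (ler_norm _) dM; lra.
have Q0 := sieve_period_gt0 k M.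
have Cle : `|\sum_(0 <= i < n) (step_mean alpha k M i - euler_partial R k M)| <=
    (sieve_period k M)%:R.
  rewrite -(period_mean_step_mean alpha M k0).
  apply: le_trans (ler_norm_sum_periodic n Q0 (step_meanD alpha k M)) _.
  exact: ler_sum_period_dev (step_mean_itv k alpha01 M).
have Sdev : sieve_dev alpha k M (mkseq w n) =
    S - \sum_(0 <= i < n) step_mean alpha k M i.
  rewrite /sieve_dev size_mkseq -sumrB; apply: eq_big_nat => i /andP[_ ltin].
  by rewrite heads_mkseq ?(ltnW ltin)// nth_mkseq.
move: dS Cle A; rewrite Sdev sumrB sumr_const_nat subn0 mulr_natl !ler_norml.
by lra.
Qed.

End comparison.

(** * From a subsequence to all times *)

Section subsequence.
Context (R : realType).

Lemma leq_expS_add m j : (0 < m)%N -> (m.+1 ^ j.+1 <= m ^ j.+1 + 3 ^ j.+1 * m ^ j)%N.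
Proof.
move=> m0; elim: j => [|j IHj]; first by rewrite !expn1 expn0; lia.
rewrite [leqLHS]expnS (leq_trans (leq_mul (leqnn _) IHj))//.
have : (m ^ j <= m ^ j.+1)%N by rewrite leq_pexp2l.
have : (1 <= 3 ^ j.+1)%N by rewrite expn_gt0.
rewrite !expnS; move: (m ^ j)%N (3 ^ j)%N => u v.
by nia.
Qed.

Lemma between_powers m0 j n : (0 < j)%N -> (m0 ^ j <= n)%N ->
  exists m, (m0 <= m)%N /\ (m ^ j <= n < m.+1 ^ j)%N.
Proof.
move=> j0 mn; have [||m mP mmax] := @ex_maxnP (fun m => m ^ j <= n)%N n.
- by exists m0.
- move=> i; apply: leq_trans; rewrite -[leqLHS]expn1.
  by case: i => [//|i]; rewrite leq_pexp2l.
exists m; split; first exact: mmax.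
by rewrite mP ltnNge; apply/negP => /mmax; rewrite ltnn.
Qed.

(** Consecutive twelfth powers have ratio tending to 1 and the terms are
    bounded, so between two of them the averages hardly move.  Letting M grow
    removes the error proportional to 1 / M. *)
Lemma cvg_average_subsequence (t : nat -> R) (L : nat -> R) (l c : R) (K : nat -> R) :
  (forall i, 0 <= t i <= 1) -> L n @[n --> \oo] --> l ->
  (forall M, (0 < M)%N -> exists m0, forall m, (m0 <= m)%N ->
    `|\sum_(0 <= i < m ^ 12) t i - (m ^ 12)%:R * L M| <=
    c * ((m ^ 12)%:R / M%:R) + K M) ->
  (\sum_(1 <= i < n.+1) t i) / n%:R @[n --> \oo] --> l.
Proof.
move=> t01 Ll tL; apply/cvgrPdist_le => /= eps eps0.
have e5 : 0 < eps / 5 by rewrite divr_gt0.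
have [M [M0 [cM LM]]] : exists M, (0 < M)%N /\ c / M%:R <= eps / 5 /\
    `|l - L M| <= eps / 5.
  have : \forall M \near \oo, [/\ (0 < M)%N, c / M%:R <= eps / 5 &
      `|l - L M| <= eps / 5].
    near=> M; split; [by near: M; exact: nbhs_infty_gt| |]; last first.
      by near: M; move/cvgrPdist_le: Ll; exact.
    have M0 : 0 < M%:R :> R by rewrite ltr0n; near: M; exact: nbhs_infty_gt.
    rewrite ler_pdivrMr// -ler_pdivrMl//; near: M; exact: nbhs_infty_ger.
  by move=> [N _ /(_ N (leqnn N))[]]; exists N.
have [m0 Hm0] := tL M M0.
have [m1 [m1m0 [m10 [Km1 Rm1]]]] : exists m1, (m0 <= m1)%N /\ (0 < m1)%N /\
    K M <= eps / 5 * m1%:R /\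
    (3 ^ 12)%:R * (1 + `|l|) + 1 <= eps / 5 * m1%:R.
  have : \forall m \near \oo, [/\ (m0 <= m)%N, (0 < m)%N, K M <= eps / 5 * m%:R &
      (3 ^ 12)%:R * (1 + `|l|) + 1 <= eps / 5 * m%:R].
    near=> m; split; [by near: m; exact: nbhs_infty_ge|
      by near: m; exact: nbhs_infty_gt| |];
    by rewrite -ler_pdivrMl//; near: m; exact: nbhs_infty_ger.
  by move=> [N _ /(_ N (leqnn N))[]]; exists N.
exists (m1 ^ 12)%N => // n /= m1n.
have [m [m1m /andP[mn nm]]] := between_powers (isT : (0 < 12)%N) m1n.
have m0' : (0 < m)%N := leq_trans m10 m1m.
have mpos : 1 <= m%:R :> R by rewrite ler1n.
have Nn : 0 < (m ^ 12)%:R :> R by rewrite ltr0n expn_gt0 m0'.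
have n0 : 0 < n%:R :> R by rewrite (lt_le_trans Nn)// ler_nat.
have := Hm0 m (leq_trans m1m0 m1m).
have r_le : (n - m ^ 12)%:R <= (3 ^ 12)%:R * m%:R ^+ 11 :> R.
  rewrite -natrX -natrM ler_nat leq_subLR (leq_trans (ltnW nm))//.
  exact: (leq_expS_add 11 m0').
have nE : n%:R = (m ^ 12)%:R + (n - m ^ 12)%:R :> R by rewrite -natrD subnKC.
have mM : m1%:R <= m%:R :> R by rewrite ler_nat.
have m11 : 1 <= m%:R ^+ 11 :> R by rewrite exprn_ege1.
have NE : (m ^ 12)%:R = m%:R ^+ 11 * m%:R :> R by rewrite natrX -exprSr.
have tail : - 1 <= \sum_(1 <= i < n.+1) t i - \sum_(0 <= i < m ^ 12) t i <=
    (n - m ^ 12)%:R + 1.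
  have -> : \sum_(1 <= i < n.+1) t i =
      \sum_(0 <= i < m ^ 12) t i + \sum_(m ^ 12 <= i < n.+1) t i - t 0%N.
    rewrite -big_cat_nat//=; last exact: leqW.
    by rewrite [in RHS]big_ltn// addrAC subrr add0r.
  have : 0 <= \sum_(m ^ 12 <= i < n.+1) t i <= (n - m ^ 12)%:R + 1.
    rewrite sumr_ge0 => [|i _]; last by case/andP: (t01 i).
    rewrite natr1 -subSn//.
    rewrite -[leRHS](_ : \sum_(m ^ 12 <= i < n.+1) 1 = _).
      by apply: ler_sum => i _; case/andP: (t01 i).
    by rewrite sumr_const_nat.
  by have := t01 0%N; lra.
have -> : l - (\sum_(1 <= i < n.+1) t i) / n%:R =
    (n%:R * l - \sum_(1 <= i < n.+1) t i) / n%:R by field; rewrite gt_eqF.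
rewrite normrM (@gtr0_norm _ n%:R^-1) ?invr_gt0// ler_pdivrMr// nE.
move: tail r_le NE Nn; set N := (m ^ 12)%:R; set r := (n - m ^ 12)%:R.
set S := \sum_(1 <= i < n.+1) t i; set s := \sum_(0 <= i < m ^ 12) t i.
move: m11; set u := m%:R ^+ 11 => u1 tail r_le NE Nn sL.
have r0 : 0 <= r by [].
have -> : (N + r) * l - S = - (s - N * L M) + N * (l - L M) + r * l - (S - s).
  by ring.
have b1 : `|N * (l - L M)| <= N * (eps / 5).
  by rewrite normrM gtr0_norm// ler_pM2l.
have b2 : `|r * l| <= r * `|l| by rewrite normrM ger0_norm.
have b3 : `|S - s| <= r + 1 by rewrite ler_norml; lra.
have b4 : c * (N / M%:R) <= N * (eps / 5).
  by rewrite mulrCA ler_pM2l.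
have b5 : K M <= N * (eps / 5).
  apply: le_trans Km1 _; rewrite mulrC ler_pM2r// NE (le_trans mM)//.
  by rewrite ler_peMl//; lra.
have b6 : r * (1 + `|l|) + 1 <= N * (eps / 5).
  apply: (@le_trans _ _ (u * ((3 ^ 12)%:R * (1 + `|l|) + 1))).
    rewrite (mulrDr u) mulr1 lerD// mulrA ler_wpM2r//.
    by rewrite (mulrC u).
  rewrite NE -mulrA ler_wpM2l//; first by lra.
  by apply: le_trans Rm1 _; rewrite mulrC ler_pM2r.
apply: le_trans (ler_normB _ _) _.
apply: le_trans (lerD (ler_normD _ _) (lexx _)) _.
apply: le_trans (lerD (lerD (ler_normD _ _) (lexx _)) (lexx _)) _.
rewrite normrN.
have : r * eps >= 0 by rewrite mulr_ge0// ltW.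
by nra.
Unshelve. all: by end_near. Qed.

End subsequence.

(** * Transfer to the probability space *)

Section coin_law.
Context (d : measure_display) (T : measurableType d) (R : realType)
  (P : probability T R).

(** The first Borel-Cantelli lemma for a summable bound of order m^(-2). *)
Lemma ae_eventually_not (F : nat -> set T) (C : R) : 0 <= C ->
  (forall m, measurable (F m)) ->
  (forall m, (0 < m)%N -> (P (F m) <= (C / m%:R ^+ 2)%:E)%E) ->
  {ae P, forall t, exists m0, forall m, (m0 <= m)%N -> ~ F m t}.
Proof.
move=> C0 mF PF.
have : P (lim_sup_set (fun m => F m.+1)) = 0%E.
  apply: lim_sup_set_cvg0 => //; apply: (@le_lt_trans _ _ (2 * C)%:E); last exact: ltry.
  apply: lime_le; first by apply: is_cvg_nneseries => m _ _; exact: measure_ge0.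
  apply: nearW => n /=.
  apply: (@le_trans _ _ (\sum_(0 <= m < n) (C / m.+1%:R ^+ 2)%:E)%E).
    by apply: lee_sum => m _; exact: PF.
  rewrite sumEFin lee_fin -mulr_sumr mulrC ler_wpM2r//.
  have := @sum_inv_sqr R 1 n.+1 isT; rewrite divr1 big_add1/=.
  by apply: le_trans.
move=> lim0; exists (lim_sup_set (fun m => F m.+1)); split=> //.
  apply: bigcap_measurable => // n _; exact: bigcup_measurable.
move=> t /= N n _; apply: contrapT => NF; apply: N; exists n.+1 => -[//|m] nm Ft.
by apply: NF; exists m.
Qed.

Context (alpha : R) (b : nat -> T -> bool).

Definition coins n t : seq bool := mkseq (b^~ t) n.

Definition prefix_weight (u : seq bool) : R :=
  \prod_(x <- u) (if x then alpha else 1 - alpha).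

Hypothesis coins_law : forall u, measurable [set t | coins (size u) t = u] /\
  P [set t | coins (size u) t = u] = (prefix_weight u)%:E.

(** The induction on n splits the event by the first coin after the prefix u,
    exactly as the recursion that defines coin_mean does. *)
Lemma coins_cylinder_law u n (A : pred (seq bool)) :
  measurable [set t | coins (size u) t = u /\ A (coins (size u + n) t)] /\
  P [set t | coins (size u) t = u /\ A (coins (size u + n) t)] =
    (prefix_weight u * coin_mean alpha n (fun v => (A (u ++ v))%:R))%:E.
Proof.
elim: n u => [|n IHn] u.
  rewrite /= cats0 addn0; case Au: (A u).
    have -> : [set t | coins (size u) t = u /\ A (coins (size u) t)] =
        [set t | coins (size u) t = u].
      by apply/seteqP; split=> t /= [] // ->.
    by rewrite mulr1; exact: coins_law.
  have -> : [set t | coins (size u) t = u /\ A (coins (size u) t)] = set0.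
    by apply/seteqP; split=> t //= [] ->; rewrite Au.
  by rewrite mulr0 measure0.
have coinsS m t : coins m.+1 t = rcons (coins m t) (b m t).
  by rewrite /coins mkseqS.
have -> : [set t | coins (size u) t = u /\ A (coins (size u + n.+1) t)] =
    [set t | coins (size (rcons u true)) t = rcons u true /\
      A (coins (size (rcons u true) + n) t)] `|`
    [set t | coins (size (rcons u false)) t = rcons u false /\
      A (coins (size (rcons u false) + n) t)].
  apply/seteqP; split=> t /=; rewrite !size_rcons coinsS addSnnS.
    by move=> [-> At]; case: (b _ t); [left|right].
  by case=> -[/rcons_inj[-> _]].
have [m1 P1] := IHn (rcons u true); have [m2 P2] := IHn (rcons u false).
split; first exact: measurableU.
rewrite measureU//; last first.
  apply/seteqP; split=> t //= -[[+ _] [+ _]]; rewrite !size_rcons => ->.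
  by move=> /rcons_inj[].
apply: (etrans (congr2 (fun x y => x + y)%E P1 P2)).
rewrite -EFinD /prefix_weight -!cats1 !big_cat !big_seq1 /=.
have catE x : coin_mean alpha n (fun v => (A ((u ++ [:: x]) ++ v))%:R) =
    coin_mean alpha n (fun v => (A (u ++ x :: v))%:R).
  by apply: eq_coin_mean => v _; rewrite -catA.
by rewrite !catE; congr EFin; ring.
Qed.

Lemma coins_lawP n (A : pred (seq bool)) :
  measurable [set t | A (coins n t)] /\
  P [set t | A (coins n t)] = (coin_mean alpha n (fun v => (A v)%:R))%:E.
Proof.
have [] := coins_cylinder_law [::] n A.
rewrite /prefix_weight big_nil mul1r add0n /=.
have -> : [set t | coins 0 t = [::] /\ A (coins n t)] = [set t | A (coins n t)].
  by apply/seteqP; split=> t //= [].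
by [].
Qed.

End coin_law.

Section walk.
Context (d : measure_display) (T : measurableType d) (R : realType)
  (P : probability T R) (alpha : R) (xi : nat -> {RV P >-> (int * int)%type}).
Hypothesis xi_indep : mutually_independent xi.
Hypothesis xi10 : forall i, P (xi i @^-1` [set (1, 0)]) = alpha%:E.
Hypothesis xi01 : forall i, P (xi i @^-1` [set (0, 1)]) = (1 - alpha)%:E.

Definition east i t : bool := xi i t == (1, 0).

Lemma measurable_set1_int2 (v : int * int) : measurable [set v].
Proof.
have -> : [set v] = [set v.1] `*` [set v.2].
  by apply/seteqP; split=> -[x y] /=; case: v => a b /= [-> ->].
exact: measurableX.
Qed.

Lemma measurable_step i v : measurable (xi i @^-1` [set v]).
Proof.
rewrite -[_ @^-1` _]setTI; apply: measurable_funPT => //.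
exact: measurable_set1_int2.
Qed.

Lemma ae_unit_step : {ae P, forall t, forall i, xi i t = (1, 0) \/ xi i t = (0, 1)}.
Proof.
apply: ae_foralln => i.
exists (~` (xi i @^-1` [set (1, 0)] `|` xi i @^-1` [set (0, 1)])); split.
- by apply/measurableC/measurableU; exact: measurable_step.
- have mU : measurable (xi i @^-1` [set (1, 0)] `|` xi i @^-1` [set (0, 1)]).
    by apply: measurableU; exact: measurable_step.
  have PU : P (xi i @^-1` [set (1, 0)] `|` xi i @^-1` [set (0, 1)]) = 1%E.
    have dis : xi i @^-1` [set (1, 0)] `&` xi i @^-1` [set (0, 1)] = set0.
      by apply/seteqP; split=> t //= [->].
    apply: etrans (measureU P (measurable_step _ _) (measurable_step _ _) dis) _.
    apply: (etrans (congr2 (fun x y => x + y)%E (xi10 i) (xi01 i))).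
    by rewrite -EFinD addrCA subrr addr0.
  apply: etrans (probability_setC P mU) _.
  by rewrite PU subee.
- by move=> t /= N /= [] ?; apply: N; [left|right].
Qed.

Lemma coins_east_law u : measurable [set t | coins east (size u) t = u] /\
  P [set t | coins east (size u) t = u] = (prefix_weight alpha u)%:E.
Proof.
pose J : {fset nat} := [fset i in iota 0 (size u)]%fset.
(* Every value other than (1, 0) counts as tails, so that the two cases
   exhaust the space and not merely an event of probability 1. *)
pose B i : set (int * int) :=
  if nth false u i then [set (1, 0)] else ~` [set (1, 0)].
have mB i : measurable (B i).
  rewrite /B; case: nth; [|apply: measurableC]; exact: measurable_set1_int2.
have mxB i : measurable (xi i @^-1` B i).
  by rewrite -[_ @^-1` _]setTI; apply: measurable_funPT.
have -> : [set t | coins east (size u) t = u] =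
    \bigcap_(i in [set` J]) (xi i @^-1` B i).
  apply/seteqP; split=> t /=.
    move=> tu i /=; rewrite !inE mem_iota add0n => /= iu.
    rewrite /B -tu nth_mkseq//= /east; case: eqP => //.
  move=> tJ; apply: (@eq_from_nth _ false) => [|i]; rewrite size_mkseq// => iu.
  rewrite nth_mkseq//; have := tJ i.
  rewrite /= !inE mem_iota add0n /B /east /= => /(_ iu).
  by case: nth => /= [->|/eqP/negPf]; rewrite ?eqxx.
split; first by apply: fin_bigcap_measurable => [|i _]; [exact: finite_fset|exact: mxB].
have Bw i : P (xi i @^-1` B i) = (if nth false u i then alpha else 1 - alpha)%:E.
  rewrite /B; case: nth; first exact: xi10.
  rewrite -preimage_setC.
  by apply: etrans (probability_setC P (measurable_step _ _)) _; rewrite xi10.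
apply: etrans (xi_indep (fun i _ => mB i)) _.
under eq_bigr do rewrite Bw.
have Jperm : perm_eq J (iota 0 (size u)).
  by apply: uniq_perm; rewrite ?fset_uniq ?iota_uniq// => i; rewrite !inE.
rewrite (perm_big _ Jperm)/= prodEFin /prefix_weight (big_nth false).
by rewrite /index_iota subn0.
Qed.

Lemma walk_heads (W : nat -> T -> int * int) t : W 0%N t = (0, 0) ->
  (forall i, W i.+1 t = W i t + xi i t) ->
  (forall i, xi i t = (1, 0) \/ xi i t = (0, 1)) ->
  forall i, (count id (coins east i t) <= i)%N /\
    W i t = ((count id (coins east i t))%:Z, (i - count id (coins east i t))%N%:Z).
Proof.
move=> W0 WS unit_step; elim=> [//|i [ai Wi]].
rewrite WS Wi /coins headsS /east.
case: (unit_step i) => ->; rewrite /= -/(coins east i t); split.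
- by rewrite addn1 ltnS.
- by rewrite addn1 subSS -addn1 PoszD; congr (_, _); rewrite ?addr0.
- by rewrite addn0 leqW.
- by rewrite addn0 subSn// -addn1 PoszD; congr (_, _); rewrite ?addr0.
Qed.

Lemma kfree_indicator_east k (W : nat -> T -> int * int) t : W 0%N t = (0, 0) ->
  (forall i, W i.+1 t = W i t + xi i t) ->
  (forall i, xi i t = (1, 0) \/ xi i t = (0, 1)) ->
  forall i, (0 < i)%N -> kfree_indicator R k W i t = (kfree_at k (east^~ t) i)%:R.
Proof.
move=> W0 WS unit_step i i0.
have [ai Wi] := walk_heads W0 WS unit_step i.
rewrite /kfree_indicator indicE /kfree_at; congr (nat_of_bool _)%:R.
rewrite -/(coins east i t); set a := count _ _ in ai Wi *.
rewrite Wi; apply/idP/asboolP.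
  rewrite inE => -[_] /=; rewrite /gcdz.
  by rewrite -(gcdnDl a (i - a)) subnKC.
move=> K; rewrite inE; split; last first.
  by rewrite /gcdz !absz_nat -(gcdnDl a (i - a)) subnKC.
apply/eqP => -[a0 ia0]; move: i0.
by rewrite -(subnKC ai) ia0 a0.
Qed.

End walk.

(** * Convergence of the averages *)

Unset Implicit Arguments.
Set Strict Implicit.

Theorem theorem1p2 (d : measure_display) (T : measurableType d) (R : realType)
    (P : probability T R) (alpha : R) (k : nat) (W : nat -> T -> int * int) :
  0 < alpha < 1 ->
  (1 <= k)%N ->
  alpha_random_walk P alpha W ->
  {ae P, forall t, Tbar R k W n t @[n --> \oo] --> euler_product R k}.
Proof.
move=> alpha01 k0 [xi [indep x10 x01 W0 WS]].
have law := coins_lawP (coins_east_law indep x10).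
have typical : {ae P, forall t, forall M, exists m0, forall m, (m0 <= m)%N ->
    ~ atypical alpha k M.+1 (m ^ 2) (coins (east xi) (m ^ 12) t)}.
  apply: ae_foralln => M.
  have [C [C0 PC]] := coin_mean_atypical k alpha01 (ltn0Sn M).
  apply: (ae_eventually_not C0) => [m|m m0]; first exact: (law _ _).1.
  by rewrite (law _ _).2 lee_fin PC.
have := ae_unit_step x10 x01; apply: filterS2 typical => t typ unit_step.
pose x i := kfree_at k ((east xi)^~ t) i.
have TE n : Tbar R k W n t = (\sum_(1 <= i < n.+1) (x i && x i.+1)%:R) / n%:R.
  congr (_ / _); apply: eq_big_nat => i /andP[i0 _].
  rewrite !(kfree_indicator_east k (W0 t) (WS^~ t) unit_step)//.
  by rewrite -natrM mulnb.
under eq_fun do rewrite TE.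
apply: (@cvg_average_subsequence _ _ (euler_partial R k) _ 9
  (fun M => 3 + (sieve_period k M)%:R)).
- by move=> i; rewrite ler0n lern1 leq_b1.
- exact: is_cvg_euler_partial.
move=> [//|M] _; have [m0 Hm] := typ M.
exists (maxn m0 M.+1) => m; rewrite geq_max => /andP[m0m Mm].
apply: (sum_kfree_typical alpha01 k0) => //.
- apply: (leq_trans Mm); rewrite -[leqLHS]expn1 leq_pexp2l//.
  exact: leq_trans Mm.
- exact: leq_trans Mm.
- by apply/negP; exact: Hm.
Qed.
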